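(* Let $\{\pi^k\}_{k\ge0}$ be generated by entropy softmax policy gradient with any constant step size $\eta\in(0,\beta)$, where $\beta$ is the unique solution $x$ of $$\exp\left(-\frac{2x(1+\tau\log|\mathcal{A}|)}{(1-\gamma)^2}\right)-\frac{\tau x}{2(1-\gamma)}=0.$$ Then for all $k\ge0$, $$\|V_\tau^*-V_\tau^k\|_\infty\le\left(1-(1-\gamma)\,\eta\,\tilde\mu\,\tau\,\kappa^2\left[2\exp\left(-\frac{2\eta(1+\tau\log|\mathcal{A}|)}{(1-\gamma)^2}\right)-\frac{\tau\eta}{1-\gamma}\right]\right)^k\|V_\tau^*-V_\tau^0\|_\infty.$$
   Context: MDP: a tuple $(\mathcal{S},\mathcal{A},P,r,\gamma)$ with finite state space $\mathcal{S}$, finite action space $\mathcal{A}$, transition probabilities $P(s'|s,a)$, reward $r:\mathcal{S}\times\mathcal{A}\to[0,1]$ and discount factor $\gamma\in[0,1)$. A policy is $\pi=(\pi(\cdot|s))_{s\in\mathcal{S}}$ with each $\pi(\cdot|s)$ a probability distribution on $\mathcal{A}$. For a regularization parameter $\tau>0$, the entropy regularized values are $V_\tau^\pi(s)=\mathbb{E}[\sum_{t\ge0}\gamma^t(r(s_t,a_t)-\tau\log\pi(a_t|s_t))\mid s_0=s,\pi]$, $Q_\tau^\pi(s,a)=r(s,a)+\gamma\,\mathbb{E}_{s'\sim P(\cdot|s,a)}[V_\tau^\pi(s')]$, $A_\tau^\pi(s,a)=Q_\tau^\pi(s,a)-\tau\log\pi(a|s)-V_\tau^\pi(s)$. $V_\tau^*(s)=\max_\pi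 V_\tau^\pi(s)$ is the optimal regularized value. For policies $\pi^k$, write $V_\tau^k,A_\tau^k$ for $V_\tau^{\pi^k},A_\tau^{\pi^k}$. $\|\cdot\|_\infty$ is the maximum absolute entry. The visitation measure is $d_\mu^\pi(s)=(1-\gamma)\mathbb{E}[\sum_{t\ge0}\gamma^t\mathbf{1}\{s_t=s\}\mid s_0\sim\mu,\pi]$ and $d_\mu^k=d_\mu^{\pi^k}$; the distribution $\mu$ on $\mathcal{S}$ is fixed with $\tilde\mu=\min_s\mu(s)>0$. Entropy softmax PG: start from any softmax policy $\pi^0$ (all entries positive) and iterate $$\pi^{k+1}(a|s)\propto\pi^k(a|s)\exp\left(\eta_s\,\pi^k(a|s)A_\tau^k(s,a)\right),\qquad\eta_s=\frac{\eta}{1-\gamma}d_\mu^k(s),$$ normalized over $a$ for each $s$. $\kappa:=\inf_{k\ge0}\min_{s,a}\pi^k(a|s)$ along the generated sequence (the paper establishes that $\kappa>0$ for $\eta\in(0,\beta)$). *)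

(* Defs.v *)
From HB Require Import structures.
From mathcomp Require Import all_boot all_order all_algebra.
From mathcomp Require Import all_classical all_reals all_analysis.

Set Implicit Arguments.
Unset Strict Implicit.
Unset Printing Implicit Defensive.

Import Order.TTheory GRing.Theory Num.Theory.
Import numFieldNormedType.Exports.

Local Open Scope classical_set_scope.
Local Open Scope ring_scope.

Definition is_dist (R : realType) (T : finType) (p : T -> R) : Prop :=
  (forall x, 0 <= p x) /\ \sum_x p x = 1.

Definition dirac_dist (R : realType) (T : finType) (x0 : T) : T -> R :=
  fun x => (x == x0)%:R.

Record mdp (R : realType) (S A : finType) := MDP {
  trans : S -> A -> S -> R;
  reward : S -> A -> R;
  discount : R;
  trans_dist : forall s a, is_dist (trans s a);
  reward_01 : forall s a, 0 <= reward s a <= 1;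
  discount_01 : 0 <= discount < 1 }.

Definition is_policy (R : realType) (S A : finType) (pi : S -> A -> R) : Prop :=
  forall s, is_dist (pi s).

Definition is_softmax_policy (R : realType) (S A : finType)
    (pi : S -> A -> R) : Prop :=
  is_policy pi /\ forall s a, 0 < pi s a.

(* Probability that (s_0,a_0), ..., (s_T,a_T) is the trajectory [w], for
   s_0 ~ rho, a_t ~ pi(.|s_t) and s_{t+1} ~ P(.|s_t,a_t). *)
Definition traj_prob (R : realType) (S A : finType) (M : mdp R S A)
    (rho : S -> R) (pi : S -> A -> R) (T : nat)
    (w : {ffun 'I_T.+1 -> S * A}) : R :=
  rho (w ord0).1 * (\prod_(t < T.+1) pi (w t).1 (w t).2)
  * (\prod_(t < T) trans M (w (widen_ord (leqnSn T) t)).1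
                           (w (widen_ord (leqnSn T) t)).2
                           (w (lift ord0 t)).1).

Definition traj_expectation (R : realType) (S A : finType) (M : mdp R S A)
    (rho : S -> R) (pi : S -> A -> R) (T : nat)
    (F : {ffun 'I_T.+1 -> S * A} -> R) : R :=
  \sum_w traj_prob M rho pi w * F w.

(* E[sum_{t >= 0} gamma^t f(s_t,a_t) | s_0 ~ rho, pi], as the limit of the
   expectations of the truncated sums.  [S] and [A] being finite, [f] is
   bounded, so the limit exists. *)
Definition discounted_sum (R : realType) (S A : finType) (M : mdp R S A)
    (rho : S -> R) (pi : S -> A -> R) (f : S -> A -> R) : R :=
  limn (fun T : nat => traj_expectation M rho pi
    (fun w : {ffun 'I_T.+1 -> S * A} =>
       \sum_(t < T.+1) discount M ^+ t * f (w t).1 (w t).2)).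

(* Actions with [pi s a = 0] have probability zero, so the value [ln 0 = 0]
   of the library does not affect the expectation. *)
Definition V_ (R : realType) (S A : finType) (M : mdp R S A) (tau : R)
    (pi : S -> A -> R) (s : S) : R :=
  discounted_sum M (dirac_dist R s) pi
    (fun s' a' => reward M s' a' - tau * ln (pi s' a')).

Definition Q_ (R : realType) (S A : finType) (M : mdp R S A) (tau : R)
    (pi : S -> A -> R) (s : S) (a : A) : R :=
  reward M s a + discount M * \sum_s' trans M s a s' * V_ M tau pi s'.

Definition A_ (R : realType) (S A : finType) (M : mdp R S A) (tau : R)
    (pi : S -> A -> R) (s : S) (a : A) : R :=
  Q_ M tau pi s a - tau * ln (pi s a) - V_ M tau pi s.

(* The maximum over all policies, which is attained, written as a supremum. *)
Definition Vstar (R : realType) (S A : finType) (M : mdp R S A) (tau : R)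
    (s : S) : R :=
  sup [set V_ M tau pi s | pi in [set pi : S -> A -> R | is_policy pi]].

Definition visitation (R : realType) (S A : finType) (M : mdp R S A)
    (mu : S -> R) (pi : S -> A -> R) (s : S) : R :=
  (1 - discount M) * discounted_sum M mu pi (fun s' _ => (s' == s)%:R).

Definition norm_oo (R : realType) (S : finType) (v : S -> R) : R :=
  \big[Num.max/0]_s `|v s|.

(* Minimum entry of a distribution; its entries are at most 1, so the default
   value 1 is harmless. *)
Definition min_prob (R : realType) (T : finType) (p : T -> R) : R :=
  \big[Num.min/1]_x p x.

Definition pg_weight (R : realType) (S A : finType) (M : mdp R S A)
    (mu : S -> R) (tau eta : R) (pi : S -> A -> R) (s : S) (a : A) : R :=
  let eta_s := eta / (1 - discount M) * visitation M mu pi s in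
  pi s a * expR (eta_s * pi s a * A_ M tau pi s a).

Definition pg_step (R : realType) (S A : finType) (M : mdp R S A)
    (mu : S -> R) (tau eta : R) (pi : S -> A -> R) : S -> A -> R :=
  fun s a => pg_weight M mu tau eta pi s a
             / \sum_b pg_weight M mu tau eta pi s b.

Definition entropy_softmax_pg (R : realType) (S A : finType) (M : mdp R S A)
    (mu : S -> R) (tau eta : R) (pi0 : S -> A -> R) (k : nat) : S -> A -> R :=
  iter k (pg_step M mu tau eta) pi0.

Definition kappa (R : realType) (S A : finType) (pis : nat -> S -> A -> R) : R :=
  inf (range (fun k => min_prob (fun sa : S * A => pis k sa.1 sa.2))).

Definition exp_factor (R : realType) (S A : finType) (M : mdp R S A)
    (tau x : R) : R :=
  expR (- (2 * x * (1 + tau * ln (#|A|%:R)) / (1 - discount M) ^+ 2)).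

Definition beta_equation (R : realType) (S A : finType) (M : mdp R S A)
    (tau x : R) : Prop :=
  exp_factor M tau x - tau * x / (2 * (1 - discount M)) = 0.

(* Main.v *)
(* Fix an iterate pi with value V and advantage A, so that the pi-mean of A
   vanishes in each state.  For any policy p, one regularized Bellman step gives
   T_p V - V = E_p[A] - tau KL(p || pi), which by the Gibbs variational
   principle and Hoeffding's lemma is at most |A|^2 / (2 tau).  For the new
   policy pi', put x = pi A and X = max |x|, so that |x| <= V; then
   E_pi'[A] >= eta_s X^2 exp(- 2 eta_s X) and KL(pi' || pi) <= (eta_s X)^2 / 2
   (Hoeffding under pi').  Since X >= kappa |A| and
   eta mu(s) <= eta_s <= eta / (1 - gamma), the gain T_pi' V - V is at least c
   times the gain of any other policy, with
   c = eta mu~ tau kappa^2 [2 exp(..) - tau eta / (1 - gamma)] in [0, 1], and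
   this contracts the sup-norm error by 1 - (1 - gamma) c. *)

Require Import Defs.
From HB Require Import structures.
From mathcomp Require Import all_boot all_order all_algebra.
From mathcomp Require Import all_classical all_reals all_analysis.
From mathcomp Require Import ring lra.
Set Implicit Arguments.
Unset Strict Implicit.
Unset Printing Implicit Defensive.
Import Order.TTheory GRing.Theory Num.Theory.
Import numFieldNormedType.Exports.
Local Open Scope ring_scope.

(** * Exponential moments of finite distributions *)

Lemma le_at0_of_derive_le0 (R : realType) (f f' : R -> R) :
  (forall x : R, is_derive x 1 f (f' x)) -> (forall x, 0 <= x -> f' x <= 0) ->
  forall x, 0 <= x -> f x <= f 0.
Proof.
move=> df f'_le0 x x_ge0.
have cf : {within `[0, x], continuous f}%classic.
  by apply: derivable_within_continuous => y _; exact: ex_derive.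
have [c + fx] := MVT_segment x_ge0 (fun y _ => df y) cf.
rewrite in_itv/= => /andP[c_ge0 _].
by rewrite -subr_le0 fx mulr_le0_ge0 ?subr0 ?f'_le0.
Qed.

(** The coefficients [c] are arbitrary so that the lemma applies to its own output: [p], then
    [p * Y], give the first two derivatives of a moment generating function. *)
Lemma is_derive_sum_expR (R : realType) (A : finType) (c Y : A -> R) (t : R) :
  is_derive t 1 (fun t => \sum_a c a * expR (t * Y a))
    (\sum_a c a * Y a * expR (t * Y a)).
Proof.
rewrite [X in is_derive _ _ X _](_ : _ =
  \sum_(a <- index_enum A) (fun t => c a * expR (t * Y a))); last first.
  by apply/funext => u; rewrite fct_sumE.
elim: (index_enum A) => [|a r IH]; first by rewrite !big_nil; exact: is_derive_cst.
rewrite !big_cons; apply: is_deriveD.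
apply: is_derive_eq.
by rewrite /GRing.scale/=; ring.
Qed.

(** Total mass 1 supplies the points of [S] and [A] used for maximizers and for the positivity of
    [#|A|]. *)
Lemma dist_inhabited (R : realType) (T : finType) (p : T -> R) :
  is_dist p -> exists x, p x != 0.
Proof.
move=> [_ p_sum]; apply/existsP; apply: contraPT p_sum => /existsPn p0.
rewrite big1 => [/eqP|x _]; first by rewrite eq_sym oner_eq0.
exact/eqP/negPn/p0.
Qed.

Lemma sum_mul_gt0 (R : realType) (A : finType) (p w : A -> R) :
  is_dist p -> (forall a, 0 < w a) -> 0 < \sum_a p a * w a.
Proof.
move=> [p_ge0 p_sum] w_gt0.
have pw_ge0 a : 0 <= p a * w a by rewrite mulr_ge0 // ltW.
rewrite lt_def sumr_ge0 // andbT; apply/eqP => /psumr_eq0P pw0.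
have : \sum_a p a = 0.
  apply: big1 => a _; have /eqP := pw0 (fun b _ => pw_ge0 b) a isT.
  by rewrite mulf_eq0 (gt_eqF (w_gt0 a)) orbF => /eqP.
by rewrite p_sum => /eqP; rewrite oner_eq0.
Qed.

(* The log-moment generating function t |-> ln (\sum_a p a * expR (t * Y a)) has
   second derivative the variance of [Y] under a tilted distribution, which
   is at most m^2. *)
Lemma hoeffding (R : realType) (A : finType) (p Y : A -> R) (m : R) :
  is_dist p -> (forall a, `|Y a| <= m) ->
  ln (\sum_a p a * expR (Y a)) <= \sum_a p a * Y a + m ^+ 2 / 2.
Proof.
move=> dp Ym; have [p_ge0 p_sum] := dp.
pose e := \sum_a p a * Y a.
pose h0 t := \sum_a p a * expR (t * Y a).
pose h1 t := \sum_a p a * Y a * expR (t * Y a).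
pose h2 t := \sum_a p a * Y a * Y a * expR (t * Y a).
have h0_gt0 t : 0 < h0 t by apply: sum_mul_gt0 => // a; exact: expR_gt0.
have h0_neq0 t : h0 t != 0 by rewrite gt_eqF.
have dh0 (t : R) : is_derive t 1 h0 (h1 t) := is_derive_sum_expR p Y t.
have dh1 (t : R) : is_derive t 1 h1 (h2 t) :=
  is_derive_sum_expR (fun a => p a * Y a) Y t.
have h2_le t : h2 t <= m ^+ 2 * h0 t.
  rewrite mulr_sumr; apply: ler_sum => a _.
  rewrite (_ : p a * Y a * Y a * _ = Y a ^+ 2 * (p a * expR (t * Y a)));
    last by ring.
  apply: ler_wpM2r; first by rewrite mulr_ge0 ?expR_ge0.
  by rewrite -[Y a ^+ 2]real_normK ?num_real// lerXn2r ?nnegrE ?(le_trans _ (Ym a)).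
have h0_0 : h0 0 = 1.
  by rewrite -p_sum; apply: eq_bigr => a _; rewrite mul0r expR0 mulr1.
have h1_0 : h1 0 = e.
  by apply: eq_bigr => a _; rewrite mul0r expR0 mulr1.
(* First integration: the derivative of [h1 / h0] is [h2 / h0 - (h1 / h0) ^+ 2], at most
   [m ^+ 2]. *)
have slope t : 0 <= t -> h1 t / h0 t - (m ^+ 2 * t + e) <= 0.
  move=> t_ge0; pose D t := h1 t / h0 t - (m ^+ 2 * t + e).
  have D0 : D 0 = 0 by rewrite /D h0_0 h1_0; lra.
  rewrite -[leRHS]D0.
  apply: (@le_at0_of_derive_le0 R D
    (fun t => (h2 t * h0 t - h1 t ^+ 2) / h0 t ^+ 2 - m ^+ 2)) => // [x|x _].
    have dV := is_deriveV (h0_neq0 x) (dh0 x).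
    apply: is_derive_eq; rewrite /GRing.scale/=; move: (h0_neq0 x) => ?.
    by field.
  rewrite subr_le0 ler_pdivrMr ?exprn_gt0//.
  have := ler_wpM2r (ltW (h0_gt0 x)) (h2_le x).
  have := sqr_ge0 (h1 x); lra.
(* Second integration: the derivative of [G] is the quantity bounded by [slope], [G 0 = 0], and
   [G 1 <= 0] is the claim. *)
pose G t := ln (h0 t) - (m ^+ 2 / 2 * t ^+ 2 + e * t).
have : G 1 <= G 0.
  apply: (@le_at0_of_derive_le0 R G (fun t => h1 t / h0 t - (m ^+ 2 * t + e))) => // x.
  have dl : is_derive x 1 (@ln R \o h0) (h1 x * (h0 x)^-1).
    by rewrite mulrC; exact: is_derive1_comp (is_derive1_ln (h0_gt0 x)) (dh0 x).
  rewrite /G; apply: is_derive_eq; rewrite /GRing.scale/= /GRing.scale/=.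
  by field.
rewrite /G h0_0 ln1 (_ : h0 1 = \sum_a p a * expR (Y a)); last first.
  by apply: eq_bigr => a _; rewrite mul1r.
rewrite -/e; lra.
Qed.

Lemma ler_ln_sub1 (R : realType) (x : R) : 0 < x -> ln x <= x - 1.
Proof.
move=> x_gt0; rewrite lerBrDl -[leRHS](@lnK _ x) ?posrE//.
exact: expR_ge1Dx.
Qed.

(* Here [ln (p a)] is the junk value 0 when [p a = 0], and is multiplied by 0. *)
Lemma gibbs_variational (R : realType) (A : finType) (p q : A -> R) :
  is_dist p -> (forall a, 0 < q a) ->
  \sum_a p a * (ln (q a) - ln (p a)) <= ln (\sum_a q a).
Proof.
move=> dp q_gt0; have [p_ge0 p_sum] := dp.
set Z := \sum_a q a.
have Z_gt0 : 0 < Z.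
  have [a _] := dist_inhabited dp.
  rewrite /Z (bigD1 a)//= ltr_wpDr// sumr_ge0// => b _; exact: ltW.
(* For [p a > 0] this is [ln x <= x - 1] at [x = q a / (Z * p a)]; the corrections [q a / Z - p a]
   sum to 0. *)
have term a : p a * (ln (q a) - ln (p a)) <= p a * ln Z + (q a / Z - p a).
  have [->|/eqP pa_neq0] := eqVneq (p a) 0.
    by rewrite !mul0r add0r subr0 divr_ge0 ?ltW.
  have pa_gt0 : 0 < p a by rewrite lt_def p_ge0 andbT; exact/eqP.
  have r_gt0 : 0 < q a / (Z * p a) by rewrite divr_gt0 ?mulr_gt0.
  have := ler_wpM2l (ltW pa_gt0) (ler_ln_sub1 r_gt0).
  rewrite ln_div ?posrE ?mulr_gt0// lnM ?posrE//.
  rewrite (_ : p a * (q a / (Z * p a) - 1) = q a / Z - p a); first lra.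
  by field; rewrite !gt_eqF.
apply: le_trans (ler_sum _ (fun a _ => term a)) _.
by rewrite big_split/= sumrB -!mulr_suml p_sum -/Z divff ?gt_eqF// subrr addr0 mul1r.
Qed.

(** * Trajectory sums and Bellman iteration *)

Definition ffun_cons (X : Type) (n : nat) (x : X) (w : {ffun 'I_n -> X}) :
    {ffun 'I_n.+1 -> X} :=
  [ffun i => oapp w x (unlift ord0 i)].

Lemma ffun_cons0 (X : Type) (n : nat) (x : X) (w : {ffun 'I_n -> X}) :
  ffun_cons x w ord0 = x.
Proof. by rewrite ffunE unlift_none. Qed.

Lemma ffun_consS (X : Type) (n : nat) (x : X) (w : {ffun 'I_n -> X}) (i : 'I_n) :
  ffun_cons x w (lift ord0 i) = w i.
Proof. by rewrite ffunE liftK. Qed.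

Lemma ffun_cons_bij (X : finType) (n : nat) :
  bijective (fun xw : X * {ffun 'I_n -> X} => ffun_cons xw.1 xw.2).
Proof.
exists (fun w : {ffun 'I_n.+1 -> X} =>
  (w ord0, [ffun i : 'I_n => w (lift ord0 i)])) => [[x w]|w] /=.
  rewrite ffun_cons0; congr (_, _).
  by apply/ffunP => i; rewrite ffunE ffun_consS.
apply/ffunP => i; case: (unliftP ord0 i) => [j|] ->.
  by rewrite ffun_consS ffunE.
by rewrite ffun_cons0.
Qed.

Lemma sum_ffun_cons (R : realType) (S A : finType) (n : nat)
    (F : {ffun 'I_n.+1 -> S * A} -> R) :
  \sum_w F w =
  \sum_s \sum_a \sum_(w : {ffun 'I_n -> S * A}) F (ffun_cons (s, a) w).
Proof.
rewrite (pair_big xpredT xpredT (fun s a => \sum_w F (ffun_cons (s, a) w)))/=.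
under [RHS]eq_bigr => p _ do under eq_bigr do rewrite -surjective_pairing.
rewrite pair_big.
rewrite (reindex (fun xw : _ * {ffun 'I_n -> S * A} => ffun_cons xw.1 xw.2)) //=.
exact/onW_bij/ffun_cons_bij.
Qed.

(** Markov property: after the first pair, the rest is a trajectory whose initial law is a
    transition distribution. This is why inductions on the horizon quantify over [rho]. *)
Lemma traj_prob_cons (R : realType) (S A : finType) (M : mdp R S A)
    (rho : S -> R) (pi : S -> A -> R) (T : nat) (x : S * A)
    (w : {ffun 'I_T.+1 -> S * A}) :
  traj_prob M rho pi (ffun_cons x w) =
  rho x.1 * pi x.1 x.2 * traj_prob M (trans M x.1 x.2) pi w.
Proof.
rewrite /traj_prob ffun_cons0 big_ord_recl ffun_cons0 [X in _ * X = _]big_ord_recl.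
rewrite (_ : widen_ord _ ord0 = ord0) ?ffun_cons0 ?ffun_consS; last exact: val_inj.
under eq_bigr do rewrite ffun_consS.
under [X in _ * _ * (_ * X)]eq_bigr => t _.
  rewrite (_ : widen_ord _ (lift ord0 t) =
    lift ord0 (widen_ord (leqnSn T) t)); last exact: val_inj.
  rewrite !ffun_consS; over.
by rewrite -!mulrA; do 2!congr (_ * _); rewrite mulrCA.
Qed.

(** The stage reward [f] is a parameter: the entropy-regularized reward for values, a state
    indicator for visitation. *)
Definition bellman (R : realType) (S A : finType) (M : mdp R S A)
    (pi : S -> A -> R) (f : S -> A -> R) (v : S -> R) (s : S) : R :=
  \sum_a pi s a * (f s a + discount M * \sum_s' trans M s a s' * v s').

Lemma sum_traj_prob (R : realType) (S A : finType) (M : mdp R S A)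
    (pi : S -> A -> R) (hpi : is_policy pi) (T : nat) (rho : S -> R) :
  \sum_(w : {ffun 'I_T.+1 -> S * A}) traj_prob M rho pi w = \sum_s rho s.
Proof.
elim: T rho => [|T IH] rho; rewrite sum_ffun_cons.
  apply: eq_bigr => s _; rewrite -[RHS]mulr1 -(hpi s).2 mulr_sumr.
  (* There is a single function on ['I_0]; the constant [(s, a)] merely names it. *)
  apply: eq_bigr => a _; rewrite (big_pred1 [ffun=> (s, a)]) => [|w]; last first.
    by apply/esym/eqP/ffunP => -[].
  by rewrite /traj_prob big_ord0 mulr1 big_ord1 ffun_cons0.
apply: eq_bigr => s _; rewrite -[RHS]mulr1 -(hpi s).2 mulr_sumr.
apply: eq_bigr => a _; under eq_bigr do rewrite traj_prob_cons/=.
by rewrite -mulr_sumr IH (trans_dist M s a).2 mulr1.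
Qed.

(** Conditioning on the first pair peels off one Bellman step. A horizon [T] carries [T.+1] rewards,
    hence [T.+1] iterations from zero. *)
Lemma traj_expectation_iter (R : realType) (S A : finType) (M : mdp R S A)
    (pi : S -> A -> R) (hpi : is_policy pi) (f : S -> A -> R) (T : nat)
    (rho : S -> R) :
  traj_expectation M rho pi (fun w : {ffun 'I_T.+1 -> S * A} =>
    \sum_(t < T.+1) discount M ^+ t * f (w t).1 (w t).2) =
  \sum_s rho s * iter T.+1 (bellman M pi f) (fun=> 0) s.
Proof.
elim: T rho => [|T IH] rho; rewrite /traj_expectation sum_ffun_cons/=.
  apply: eq_bigr => s _; rewrite mulr_sumr.
  apply: eq_bigr => a _; rewrite (big_pred1 [ffun=> (s, a)]) => [|w]; last first.
    by apply/esym/eqP/ffunP => -[].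
  rewrite /traj_prob big_ord0 !big_ord1 ffun_cons0/= expr0 mulr1 mul1r.
  by rewrite big1 ?mulr0 ?addr0 ?mulrA// => s' _; rewrite mulr0.
apply: eq_bigr => s _; rewrite mulr_sumr.
apply: eq_bigr => a _; rewrite -IH mulrA mulrDr.
under eq_bigr => w _.
  rewrite traj_prob_cons/= big_ord_recl ffun_cons0 expr0 mul1r/=.
  rewrite (_ : \sum_(i < T.+1) _ =
    discount M * \sum_(t < T.+1) discount M ^+ t * f (w t).1 (w t).2); last first.
    rewrite mulr_sumr; apply: eq_bigr => t _.
    by rewrite ffun_consS /bump leq0n add1n exprS mulrA.
  rewrite mulrDr; over.
rewrite big_split/= -mulr_suml -mulr_sumr sum_traj_prob// (trans_dist M s a).2 mulr1.
congr (_ + _); rewrite /traj_expectation !mulr_sumr; apply: eq_bigr => w _.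
ring.
Qed.

(** * Averages, the maximum principle and discounted limits *)

Lemma sum_dist_le (R : realType) (T : finType) (p g : T -> R) (b : R) :
  is_dist p -> (forall x, g x <= b) -> \sum_x p x * g x <= b.
Proof.
move=> [p_ge0 p_sum] g_le; rewrite -[leRHS]mul1r -p_sum mulr_suml.
by apply: ler_sum => x _; exact: ler_wpM2l.
Qed.

Lemma sum_dist_ge0 (R : realType) (T : finType) (p g : T -> R) :
  is_dist p -> (forall x, 0 <= g x) -> 0 <= \sum_x p x * g x.
Proof. by move=> [p_ge0 _] g_ge0; apply: sumr_ge0 => x _; exact: mulr_ge0. Qed.

Lemma sum_dirac (R : realType) (T : finType) (x : T) (g : T -> R) :
  \sum_y dirac_dist R x y * g y = g x.
Proof.
rewrite (bigD1 x)//= /dirac_dist eqxx mul1r big1 ?addr0// => y /negbTE ->.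
exact: mul0r.
Qed.

Lemma cvg_lincomb (R : realType) (I : finType) (c : I -> R) (u : I -> R ^nat)
    (l : I -> R) :
  (forall i, u i n @[n --> \oo] --> l i)%classic ->
  (\sum_i c i * u i n @[n --> \oo] --> \sum_i c i * l i)%classic.
Proof.
move=> ul; apply: cvg_big => [|i _]; first exact: add_continuous.
exact: cvgMl_tmp.
Qed.

Lemma discount_ge0 (R : realType) (S A : finType) (M : mdp R S A) :
  0 <= discount M.
Proof. by have /andP[] := discount_01 M. Qed.

Lemma subr_discount_gt0 (R : realType) (S A : finType) (M : mdp R S A) :
  0 < 1 - discount M.
Proof. by rewrite subr_gt0; have /andP[] := discount_01 M. Qed.

Lemma bellman_mono (R : realType) (S A : finType) (M : mdp R S A)
    (pi : S -> A -> R) (hpi : is_policy pi) (f : S -> A -> R) (u v : S -> R) :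
  (forall s, u s <= v s) -> forall s, bellman M pi f u s <= bellman M pi f v s.
Proof.
move=> le_uv s; apply: ler_sum => a _; apply: ler_wpM2l; first exact: (hpi s).1.
rewrite lerD2l ler_wpM2l ?discount_ge0//; apply: ler_sum => s' _.
by rewrite ler_wpM2l// (trans_dist M s a).1.
Qed.

(* Compare [u] at a maximum point with its average. *)
Lemma discounted_max_principle (R : realType) (S A : finType) (M : mdp R S A)
    (pi : S -> A -> R) (hpi : is_policy pi) (b : R) (u : S -> R) :
  (forall s, u s <=
    b + discount M * \sum_a pi s a * \sum_s' trans M s a s' * u s') ->
  forall s, u s <= b / (1 - discount M).
Proof.
move=> u_le s; have [m _ u_max] := Order.TotalTheory.arg_maxP u (isT : xpredT s).
apply: le_trans (u_max s isT) _; rewrite ler_pdivlMr ?subr_discount_gt0//.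
have avg_le : \sum_a pi m a * \sum_s' trans M m a s' * u s' <= u m.
  apply: sum_dist_le => // a; apply: sum_dist_le => [|s']; first exact: trans_dist.
  exact: u_max.
have := u_le m; have := ler_wpM2l (discount_ge0 M) avg_le; lra.
Qed.

(** Monotone convergence: with [f] nonnegative, the iterates started at zero increase, and a
    geometric series bounds them. *)
Lemma bellman_iter_cvg (R : realType) (S A : finType) (M : mdp R S A)
    (pi : S -> A -> R) (hpi : is_policy pi) (f : S -> A -> R)
    (f_ge0 : forall s a, 0 <= f s a) (s : S) :
  cvgn (fun T => iter T (bellman M pi f) (fun=> 0) s).
Proof.
apply: nondecreasing_is_cvgn.
  apply/nondecreasing_seqP => T; elim: T s => [|T IH] s; last exact: bellman_mono.
  apply: sum_dist_ge0 => // a; rewrite addr_ge0// mulr_ge0 ?discount_ge0//.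
  by apply: sum_dist_ge0 => //; exact: trans_dist.
pose B := \big[Num.max/0]_(x : S * A) f x.1 x.2.
have f_le s' a : f s' a <= B.
  exact: (le_bigmax 0 (fun x : S * A => f x.1 x.2) (s', a)).
have B_ge0 : 0 <= B by apply: bigmax_ge_id.
have gap := subr_discount_gt0 M.
exists (B / (1 - discount M)) => _ [T _ <-]; elim: T s => [|T IH] s.
  by rewrite divr_ge0// ltW.
rewrite iterS; apply: sum_dist_le => // a.
(* The bound is the fixed point of adding [B] to a discounted copy, so it survives one more
   iteration. *)
rewrite (_ : B / (1 - discount M) = B + discount M * (B / (1 - discount M))); last first.
  by field; rewrite gt_eqF.
rewrite lerD// ler_wpM2l ?discount_ge0//.
by apply: sum_dist_le => //; exact: trans_dist.
Qed.

Lemma discounted_sumE (R : realType) (S A : finType) (M : mdp R S A)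
    (pi : S -> A -> R) (hpi : is_policy pi) (f : S -> A -> R) (rho : S -> R) :
  discounted_sum M rho pi f =
  limn (fun T => \sum_s rho s * iter T.+1 (bellman M pi f) (fun=> 0) s).
Proof.
rewrite /discounted_sum (_ : (fun T => traj_expectation _ _ _ _) =
  fun T => \sum_s rho s * iter T.+1 (bellman M pi f) (fun=> 0) s)//.
by apply/funext => T; rewrite traj_expectation_iter.
Qed.

Lemma bellman_iter_cvg_discounted_sum (R : realType) (S A : finType)
    (M : mdp R S A) (pi : S -> A -> R) (hpi : is_policy pi) (f : S -> A -> R)
    (f_ge0 : forall s a, 0 <= f s a) (s : S) :
  (iter T (bellman M pi f) (fun=> 0) s @[T --> \oo] -->
   discounted_sum M (dirac_dist R s) pi f)%classic.
Proof.
have cv := @bellman_iter_cvg R S A M pi hpi f f_ge0 s.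
rewrite discounted_sumE//.
under [X in limn X]eq_fun do rewrite sum_dirac.
(* Truncation at [T] is iterate [T.+1]; the shift leaves the limit unchanged. *)
have /cvg_lim -> // : (iter T.+1 (bellman M pi f) (fun=> 0) s @[T --> \oo] -->
    limn (fun T => iter T (bellman M pi f) (fun=> 0) s))%classic.
by rewrite (@cvg_shiftS R (fun T => iter T (bellman M pi f) (fun=> 0) s)).
Qed.

Lemma discounted_sum_mean (R : realType) (S A : finType)
    (M : mdp R S A) (pi : S -> A -> R) (hpi : is_policy pi) (f : S -> A -> R)
    (f_ge0 : forall s a, 0 <= f s a) (rho : S -> R) :
  discounted_sum M rho pi f =
  \sum_s rho s * discounted_sum M (dirac_dist R s) pi f.
Proof.
rewrite discounted_sumE//; apply: cvg_lim => //.
rewrite (@cvg_shiftS R (fun T => \sum_s rho s * iter T (bellman M pi f) (fun=> 0) s)).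
apply: cvg_lincomb => s .
exact: bellman_iter_cvg_discounted_sum.
Qed.

(** The iterates and their shift by one have the same limit, and the operator, built from finite
    linear combinations, commutes with it. *)
Lemma discounted_sum_bellman (R : realType) (S A : finType)
    (M : mdp R S A) (pi : S -> A -> R) (hpi : is_policy pi) (f : S -> A -> R)
    (f_ge0 : forall s a, 0 <= f s a) (s : S) :
  discounted_sum M (dirac_dist R s) pi f =
  bellman M pi f (fun s' => discounted_sum M (dirac_dist R s') pi f) s.
Proof.
have cv := @bellman_iter_cvg_discounted_sum R S A M pi hpi f f_ge0.
apply: (@cvg_unique R) (cv s) _ => //.
rewrite /= -(@cvg_shiftS R (fun T => iter T (bellman M pi f) (fun=> 0) s)).
apply: cvg_lincomb => a; apply: cvgD; first exact: cvg_cst.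
apply: cvgMl_tmp; apply: cvg_lincomb => s'; exact: cv.
Qed.

(** * One-state inequalities for exponential tilting *)

Lemma softmax_gap_le (R : realType) (A : finType) (pi p adv : A -> R) (tau m : R) :
  0 < tau -> is_dist pi -> (forall a, 0 < pi a) -> \sum_a pi a * adv a = 0 ->
  (forall a, `|adv a| <= m) -> is_dist p ->
  \sum_a p a * (adv a - tau * (ln (p a) - ln (pi a))) <= m ^+ 2 / (2 * tau).
Proof.
move=> tau_gt0 dpi pi_gt0 adv0 adv_le dp.
(* The sum of the weights [pi a * expR (adv a / tau)] controls the left side divided by [tau];
   Hoeffding's bound on it has no linear term, since [adv] has mean zero. *)
have q_gt0 a : 0 < pi a * expR (adv a / tau) by rewrite mulr_gt0 ?expR_gt0.
have le1 := gibbs_variational dp q_gt0.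
have adv_tau_le a : `|adv a / tau| <= m / tau.
  by rewrite normrM normfV (gtr0_norm tau_gt0) ler_pM2r ?invr_gt0.
have := le_trans le1 (hoeffding dpi adv_tau_le).
rewrite (_ : \sum_a pi a * (adv a / tau) = 0); last first.
  by under eq_bigr do rewrite mulrA; rewrite -mulr_suml adv0 mul0r.
rewrite -(ler_pM2l tau_gt0) mulr_sumr => h.
rewrite (_ : m ^+ 2 / (2 * tau) = tau * (0 + (m / tau) ^+ 2 / 2)); last first.
  by field; rewrite gt_eqF.
apply: le_trans h; rewrite le_eqVlt; apply/orP; left; apply/eqP/eq_bigr => a _.
rewrite lnM ?posrE ?expR_gt0// expRK; field; exact: lt0r_neq0.
Qed.

(** With [u = eta * x], the case [x >= 0] is [expR u >= 1 + u] and the case [x < 0] is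
    [expR u * (1 - u) <= 1]. They yield the factors 1 and [expR u], both at least
    [expR (- (eta * X))]. *)
Lemma mulr_expR_sub1_ge (R : realType) (eta x X : R) : 0 <= eta -> `|x| <= X ->
  eta * x ^+ 2 * expR (- (eta * X)) <= x * (expR (eta * x) - 1).
Proof.
move=> eta_ge0 xX; have X_ge0 : 0 <= X := le_trans (normr_ge0 x) xX.
have e_le1 : expR (- (eta * X)) <= 1.
  by rewrite -expR0 ler_expR oppr_le0 mulr_ge0.
have ex2_ge0 : 0 <= eta * x ^+ 2 by rewrite mulr_ge0 ?sqr_ge0.
have [x_ge0|x_lt0] := leP 0 x.
  apply: le_trans (_ : eta * x ^+ 2 <= _); first by rewrite ler_piMr.
  rewrite (_ : eta * x ^+ 2 = x * (eta * x)); last by ring.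
  by rewrite ler_wpM2l// lerBrDl expR_ge1Dx.
have le_e : expR (- (eta * X)) <= expR (eta * x).
  rewrite ler_expR -mulrN ler_wpM2l// lerNl.
  by apply: le_trans xX; rewrite -normrN ler_norm.
apply: le_trans (ler_wpM2l ex2_ge0 le_e) _.
have le1 : expR (eta * x) * (1 - eta * x) <= 1.
  rewrite -[leRHS](expRxMexpNx_1 (eta * x)) ler_wpM2l ?expR_ge0//; exact: expR_ge1Dx.
have : 0 <= - x * (1 - expR (eta * x) * (1 - eta * x)).
  by rewrite mulr_ge0 ?subr_ge0// oppr_ge0 ltW.
lra.
Qed.

(** The update exponent makes [x = pi * adv] the natural variable, with maximal modulus [X]. The
    exponential term bounds the mean advantage, the other pays for the divergence from [pi]. *)
Lemma softmax_gain_ge (R : realType) (A : finType) (pi p adv : A -> R)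
    (tau eta X : R) (a0 : A) :
  0 <= tau -> 0 <= eta -> is_dist pi -> (forall a, 0 < pi a) ->
  \sum_a pi a * adv a = 0 ->
  X = `|pi a0 * adv a0| -> (forall a, `|pi a * adv a| <= X) ->
  (forall a, p a = pi a * expR (eta * pi a * adv a)
                   / \sum_b pi b * expR (eta * pi b * adv b)) ->
  eta * X ^+ 2 * (expR (- (2 * (eta * X))) - tau * eta / 2) <=
  \sum_a p a * (adv a - tau * (ln (p a) - ln (pi a))).
Proof.
move=> tau_ge0 eta_ge0 dpi pi_gt0 adv0 Xdef x_le pdef.
pose w a := pi a * expR (eta * pi a * adv a).
pose x a := pi a * adv a; pose Z := \sum_b w b.
have X_ge0 : 0 <= X by rewrite Xdef.
have Z_gt0 : 0 < Z by apply: sum_mul_gt0 => // a; exact: expR_gt0.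
have Z_neq0 : Z != 0 by rewrite gt_eqF.
have wE a : w a = pi a * expR (eta * x a) by rewrite /w /x mulrA.
have pE a : p a = pi a * expR (eta * x a) / Z by rewrite pdef -wE.
have w_gt0 a : 0 < w a by rewrite mulr_gt0 ?expR_gt0.
have p_gt0 a : 0 < p a by rewrite pdef divr_gt0 ?w_gt0.
have dp : is_dist p.
  split=> [a|]; first exact: ltW.
  by under eq_bigr do rewrite pdef; rewrite -mulr_suml divff.
have lnp a : ln (p a) - ln (pi a) = eta * x a - ln Z.
  rewrite pE ln_div ?posrE ?mulr_gt0 ?expR_gt0// lnM ?posrE ?expR_gt0// expRK.
  ring.
(* The left side is the divergence of [p] from [pi]. Tilting back, the [p]-mean of
   [expR (- (eta * x a))] is [Z^-1], to which Hoeffding's bound under [p] applies. *)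
have kl_le : eta * \sum_a p a * x a - ln Z <= (eta * X) ^+ 2 / 2.
  have Y_le a : `|- (eta * x a)| <= eta * X.
    rewrite normrN normrM (ger0_norm eta_ge0) ler_wpM2l//; exact: x_le.
  have := hoeffding dp Y_le.
  rewrite (_ : \sum_a p a * expR (- (eta * x a)) = Z^-1); last first.
    rewrite -[RHS]mul1r -dpi.2 mulr_suml; apply: eq_bigr => a _.
    by rewrite pE -[RHS]mulr1 -(expRxMexpNx_1 (eta * x a)); ring.
  rewrite lnV ?posrE// (_ : \sum_a p a * - (eta * x a) = - (eta * \sum_a p a * x a)).
    lra.
  by rewrite mulr_sumr -sumrN; apply: eq_bigr => a _; ring.
have Z_le : Z <= expR (eta * X).
  rewrite /Z; under eq_bigr do rewrite wE.
  apply: sum_dist_le => // a; rewrite ler_expR ler_wpM2l//.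
  exact: le_trans (ler_norm _) (x_le a).
have gain : eta * X ^+ 2 * expR (- (2 * (eta * X))) <= \sum_a p a * adv a.
  (* Subtracting the zero mean of [adv] under [pi] makes every summand nonnegative. *)
  have -> : \sum_a p a * adv a = (\sum_a x a * (expR (eta * x a) - 1)) / Z.
    under [in RHS]eq_bigr do rewrite mulrBr mulr1.
    rewrite sumrB adv0 subr0 mulr_suml; apply: eq_bigr => a _.
    by rewrite pE /x; ring.
  rewrite ler_pdivlMr//.
  have e_ge0 : 0 <= eta * X ^+ 2 * expR (- (2 * (eta * X))).
    by rewrite !mulr_ge0 ?sqr_ge0 ?expR_ge0.
  (* Of the two factors [expR (- (eta * X))], one is spent on [Z]; the other comes from the summand
     at [a0], the only one kept. *)
  apply: le_trans (ler_wpM2l e_ge0 Z_le) _.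
  rewrite -[leLHS]mulrA -expRD.
  rewrite (_ : - (2 * (eta * X)) + eta * X = - (eta * X)); last by ring.
  have X2 : X ^+ 2 = x a0 ^+ 2 by rewrite Xdef real_normK ?num_real.
  have terms a := mulr_expR_sub1_ge eta_ge0 (x_le a).
  rewrite (bigD1 a0)//= X2 ler_wpDr ?terms//; apply: sumr_ge0 => a _.
  by apply: le_trans (terms a); rewrite mulr_ge0 ?expR_ge0// mulr_ge0 ?sqr_ge0.
have -> : \sum_a p a * (adv a - tau * (ln (p a) - ln (pi a))) =
    \sum_a p a * adv a - tau * (eta * \sum_a p a * x a - ln Z).
  rewrite -[ln Z]mul1r -dp.2 mulr_suml !mulr_sumr -sumrB mulr_sumr -sumrB.
  by apply: eq_bigr => a _; rewrite lnp; ring.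
have := ler_wpM2l tau_ge0 kl_le; lra.
Qed.

(** * Entropy-regularized values and advantages *)

Definition soft_reward (R : realType) (S A : finType) (M : mdp R S A) (tau : R)
    (pi : S -> A -> R) (s : S) (a : A) : R :=
  reward M s a - tau * ln (pi s a).

Lemma dist_le1 (R : realType) (T : finType) (p : T -> R) (x : T) :
  is_dist p -> p x <= 1.
Proof.
move=> [p_ge0 <-]; rewrite (bigD1 x)//= lerDl; exact: sumr_ge0.
Qed.

(** Nonnegativity, from [ln (pi s a) <= 0], gives access to the monotone limits above. *)
Lemma soft_reward_ge0 (R : realType) (S A : finType) (M : mdp R S A) (tau : R)
    (htau : 0 < tau) (pi : S -> A -> R) (hpi : is_policy pi) (s : S) (a : A) :
  0 <= soft_reward M tau pi s a.
Proof.
have /andP[r_ge0 _] := reward_01 M s a.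
have ln_le : ln (pi s a) <= 0 by apply/ln_le0/dist_le1/hpi.
by rewrite subr_ge0; apply: le_trans r_ge0; rewrite mulr_ge0_le0 // ltW.
Qed.

Lemma bellmanE (R : realType) (S A : finType) (M : mdp R S A)
    (pi f : S -> A -> R) (v : S -> R) (s : S) :
  bellman M pi f v s = \sum_a pi s a * f s a +
    discount M * \sum_a pi s a * \sum_s' trans M s a s' * v s'.
Proof.
rewrite mulr_sumr -big_split; apply: eq_bigr => a _ /=; ring.
Qed.

Lemma bellmanB (R : realType) (S A : finType) (M : mdp R S A)
    (pi f : S -> A -> R) (u v : S -> R) (s : S) :
  bellman M pi f u s - bellman M pi f v s =
    discount M * \sum_a pi s a * \sum_s' trans M s a s' * (u s' - v s').
Proof.
rewrite !bellmanE opprD addrACA subrr add0r -mulrBr -sumrB; congr (_ * _).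
apply: eq_bigr => a _; rewrite -mulrBr -sumrB; congr (_ * _).
by apply: eq_bigr => s' _; rewrite mulrBr.
Qed.

Lemma discounted_sum_ge0 (R : realType) (S A : finType) (M : mdp R S A)
    (pi : S -> A -> R) (hpi : is_policy pi) (f : S -> A -> R)
    (f_ge0 : forall s a, 0 <= f s a) (s : S) :
  0 <= discounted_sum M (dirac_dist R s) pi f.
Proof.
pose W s' := discounted_sum M (dirac_dist R s') pi f.
have WE s' : W s' = bellman M pi f W s' by exact: discounted_sum_bellman.
(* The maximum principle is applied to [0 - W s] with [b = 0], so 0 is written as a quotient by
   [1 - discount M]. *)
rewrite -/(W s) -subr_le0 -[leRHS](mul0r (1 - discount M)^-1).
apply: (discounted_max_principle hpi (u := fun s => 0 - W s)) => s' /=.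
rewrite [leRHS]add0r -(bellmanB M pi f (fun=> 0)) -WE lerD2r.
apply: sum_dist_ge0 => // a; rewrite addr_ge0// mulr_ge0 ?discount_ge0//.
by apply: sum_dist_ge0 => //; exact: trans_dist.
Qed.

(** The upper bound is asked only of the mean of [f] under the policy: [- ln (pi s a)] is not
    uniformly bounded over policies, while its mean, the entropy, is. *)
Lemma discounted_sum_le (R : realType) (S A : finType) (M : mdp R S A)
    (pi : S -> A -> R) (hpi : is_policy pi) (f : S -> A -> R) (b : R)
    (f_ge0 : forall s a, 0 <= f s a)
    (f_le : forall s, \sum_a pi s a * f s a <= b) (s : S) :
  discounted_sum M (dirac_dist R s) pi f <= b / (1 - discount M).
Proof.
apply: (discounted_max_principle hpi
  (u := fun s => discounted_sum M (dirac_dist R s) pi f)) => s' /=.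
by rewrite discounted_sum_bellman// bellmanE lerD2r.
Qed.

Lemma V_bellman (R : realType) (S A : finType) (M : mdp R S A) (tau : R)
    (htau : 0 < tau) (pi : S -> A -> R) (hpi : is_policy pi) (s : S) :
  V_ M tau pi s = bellman M pi (soft_reward M tau pi) (V_ M tau pi) s.
Proof.
apply: (@discounted_sum_bellman R S A M pi hpi) => s' a.
exact: soft_reward_ge0.
Qed.

Lemma V_ge0 (R : realType) (S A : finType) (M : mdp R S A) (tau : R)
    (htau : 0 < tau) (pi : S -> A -> R) (hpi : is_policy pi) (s : S) :
  0 <= V_ M tau pi s.
Proof. by apply: discounted_sum_ge0 => // s' a; exact: soft_reward_ge0. Qed.

Lemma V_le (R : realType) (S A : finType) (M : mdp R S A) (tau : R)
    (htau : 0 < tau) (pi : S -> A -> R) (hpi : is_policy pi) (s : S) :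
  V_ M tau pi s <= (1 + tau * ln (#|A|%:R)) / (1 - discount M).
Proof.
apply: discounted_sum_le => // s'; first by move=> a; exact: soft_reward_ge0.
(* Entropy bound: the variational principle with all weights equal to 1. *)
have entropy_le : \sum_a pi s' a * (ln 1 - ln (pi s' a)) <= ln (#|A|%:R).
  by have := gibbs_variational (hpi s') (fun=> ltr01); rewrite sumr_const.
have reward_le : \sum_a pi s' a * reward M s' a <= 1.
  by apply: sum_dist_le => // a; have /andP[] := reward_01 M s' a.
under eq_bigr do rewrite mulrBr mulrCA.
rewrite sumrB -mulr_sumr -mulrN lerD// ler_pM2l//.
apply: le_trans entropy_le; rewrite -sumrN.
by apply: ler_sum => a _; rewrite ln1 sub0r mulrN.
Qed.

(** By monotonicity it is enough to bound [v] by the value, and their difference is at most its own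
    discounted average, so the maximum principle applies with [b = 0]. *)
Lemma bellman_le_V (R : realType) (S A : finType) (M : mdp R S A) (tau : R)
    (htau : 0 < tau) (pi : S -> A -> R) (hpi : is_policy pi) (v : S -> R) :
  (forall s, v s <= bellman M pi (soft_reward M tau pi) v s) ->
  forall s, bellman M pi (soft_reward M tau pi) v s <= V_ M tau pi s.
Proof.
move=> v_le s; rewrite V_bellman//; apply: bellman_mono => // {}s.
rewrite -subr_le0 -[leRHS](mul0r (1 - discount M)^-1).
apply: (discounted_max_principle hpi (u := fun s => v s - V_ M tau pi s)) => s' /=.
by rewrite add0r -(bellmanB M pi (soft_reward M tau pi)) -V_bellman// lerD2r.
Qed.

(** [A_] already carries [- tau * ln (pi s a)]; the second term exchanges it for the entropy term of
    [p]. *)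
Lemma bellman_V_sub (R : realType) (S A : finType) (M : mdp R S A) (tau : R)
    (pi p : S -> A -> R) (hp : is_policy p) (s : S) :
  bellman M p (soft_reward M tau p) (V_ M tau pi) s - V_ M tau pi s =
  \sum_a p s a * (A_ M tau pi s a - tau * (ln (p s a) - ln (pi s a))).
Proof.
rewrite -[V_ M tau pi s]mul1r -(hp s).2 mulr_suml -sumrB.
apply: eq_bigr => a _; rewrite /A_ /Q_ /soft_reward; ring.
Qed.

Lemma sum_pi_advantage (R : realType) (S A : finType) (M : mdp R S A) (tau : R)
    (htau : 0 < tau) (pi : S -> A -> R) (hpi : is_policy pi) (s : S) :
  \sum_a pi s a * A_ M tau pi s a = 0.
Proof.
have := bellman_V_sub M tau pi hpi s; rewrite -V_bellman// subrr => {2}->.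
by apply: eq_bigr => a _; rewrite subrr mulr0 subr0.
Qed.

(* The value is the sum of the nonnegative terms
   pi s a * (Q s a - tau * ln (pi s a)), so each is at most V s. *)
Lemma pi_advantage_le (R : realType) (S A : finType) (M : mdp R S A) (tau : R)
    (htau : 0 < tau) (pi : S -> A -> R) (hpi : is_policy pi) (s : S) (a : A) :
  `|pi s a * A_ M tau pi s a| <= (1 + tau * ln (#|A|%:R)) / (1 - discount M).
Proof.
apply: le_trans (V_le M htau hpi s).
have V0 := V_ge0 M htau hpi s.
pose q b := soft_reward M tau pi s b
  + discount M * \sum_s' trans M s b s' * V_ M tau pi s'.
have q_ge0 b : 0 <= q b.
  rewrite addr_ge0 ?soft_reward_ge0// mulr_ge0 ?discount_ge0//.
  by apply: sum_dist_ge0 => [|s']; [exact: trans_dist | exact: V_ge0].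
have pi_ge0 b : 0 <= pi s b := (hpi s).1 b.
have pq_le : pi s a * q a <= V_ M tau pi s.
  rewrite V_bellman// /bellman (bigD1 a)//= lerDl.
  by apply: sumr_ge0 => b _; rewrite mulr_ge0 ?q_ge0.
have pq_ge0 : 0 <= pi s a * q a by rewrite mulr_ge0.
rewrite (_ : pi s a * A_ M tau pi s a = pi s a * q a - pi s a * V_ M tau pi s).
  have := dist_le1 a (hpi s); have := pi_ge0 a.
  rewrite ler_norml; nra.
by rewrite /A_ /Q_ /q /soft_reward; ring.
Qed.

Lemma V_le_Vstar (R : realType) (S A : finType) (M : mdp R S A) (tau : R)
    (htau : 0 < tau) (pi : S -> A -> R) (hpi : is_policy pi) (s : S) :
  V_ M tau pi s <= Vstar M tau s.
Proof.
apply: ub_le_sup; last by exists pi.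
(* A real supremum dominates its set only if the set is bounded above; [V_le] is uniform over
   policies. *)
exists ((1 + tau * ln (#|A|%:R)) / (1 - discount M)) => _ [p hp <-].
exact: V_le.
Qed.

Lemma Vstar_le (R : realType) (S A : finType) (M : mdp R S A) (tau b : R)
    (s : S) (pi0 : S -> A -> R) :
  is_policy pi0 -> (forall pi, is_policy pi -> V_ M tau pi s <= b) ->
  Vstar M tau s <= b.
Proof.
move=> hpi0 V_le_b; apply: ge_sup => [|_ [pi hpi <-]]; last exact: V_le_b.
by exists (V_ M tau pi0 s), pi0.
Qed.

(** Lower bound: keep only the starts at [s] and their time-0 visit. Upper bound: an indicator is at
    most 1, so the discounted count is at most [1 / (1 - discount M)]. *)
Lemma visitation_bounds (R : realType) (S A : finType) (M : mdp R S A)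
    (mu : S -> R) (hmu : is_dist mu) (pi : S -> A -> R) (hpi : is_policy pi)
    (s : S) :
  (1 - discount M) * mu s <= visitation M mu pi s <= 1.
Proof.
have gap := subr_discount_gt0 M.
pose f (s' : S) (_ : A) : R := (s' == s)%:R.
have f_ge0 s' a : 0 <= f s' a by exact: ler0n.
have sum_f s' : \sum_a pi s' a * f s' a = (s' == s)%:R.
  by rewrite -mulr_suml (hpi s').2 mul1r.
have W_ge0 s' := @discounted_sum_ge0 R S A M pi hpi f f_ge0 s'.
rewrite /visitation discounted_sum_mean//; apply/andP; split.
  rewrite ler_pM2l// (bigD1 s)//= ler_wpDr//.
    by apply: sumr_ge0 => s' _; rewrite mulr_ge0// hmu.1.
  rewrite -[leLHS]mulr1 ler_wpM2l ?hmu.1// discounted_sum_bellman// bellmanE.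
  rewrite sum_f eqxx lerDl mulr_ge0 ?discount_ge0//.
  apply: sum_dist_ge0 => // a; apply: sum_dist_ge0 => // ; exact: trans_dist.
rewrite mulrC -ler_pdivlMr//; apply: sum_dist_le => // s'.
apply: discounted_sum_le => // s''; by rewrite sum_f lern1 leq_b1.
Qed.

(** * Positivity of the iterates and gain of one policy gradient step *)

Lemma pg_step_softmax (R : realType) (S A : finType) (M : mdp R S A)
    (mu : S -> R) (tau eta : R) (pi : S -> A -> R) :
  is_softmax_policy pi -> is_softmax_policy (pg_step M mu tau eta pi).
Proof.
move=> [hpi pi_gt0].
have w_gt0 s a : 0 < pg_weight M mu tau eta pi s a.
  by rewrite mulr_gt0 ?expR_gt0.
have Z_gt0 s : 0 < \sum_a pg_weight M mu tau eta pi s a.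
  by apply: sum_mul_gt0 => // a; exact: expR_gt0.
have step_gt0 s a : 0 < pg_step M mu tau eta pi s a by rewrite divr_gt0.
split=> // s; split=> [a|]; first exact: ltW.
by rewrite -mulr_suml divff// gt_eqF.
Qed.

Lemma entropy_softmax_pg_softmax (R : realType) (S A : finType) (M : mdp R S A)
    (mu : S -> R) (tau eta : R) (pi0 : S -> A -> R) (k : nat) :
  is_softmax_policy pi0 ->
  is_softmax_policy (entropy_softmax_pg M mu tau eta pi0 k).
Proof. by move=> hpi0; elim: k => //= k; exact: pg_step_softmax. Qed.

(** The gain of [p] is at most [Y ^+ 2 / (2 * tau)], that of the update at least [eta_s * X ^+ 2]
    times a bracket no smaller than [B / 2], and [kap] links [X] to [Y]. Generic lower bounds [m]
    and [kap] let one constant serve all states and iterates. *)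
Lemma pg_step_gain (R : realType) (S A : finType) (M : mdp R S A)
    (mu : S -> R) (hmu : is_dist mu) (m : R) (m_ge0 : 0 <= m)
    (m_le : forall s, m <= mu s) (tau : R) (htau : 0 < tau)
    (eta : R) (eta_ge0 : 0 <= eta) (pi : S -> A -> R)
    (hpi : is_softmax_policy pi) (kap : R) (kap_ge0 : 0 <= kap)
    (kap_le : forall s a, kap <= pi s a)
    (B : R) (Bdef : B = 2 * exp_factor M tau eta - tau * eta / (1 - discount M))
    (B_ge0 : 0 <= B) (p : S -> A -> R) (hp : is_policy p) (s : S) :
  eta * m * tau * kap ^+ 2 * B *
    (bellman M p (soft_reward M tau p) (V_ M tau pi) s - V_ M tau pi s)
  <= bellman M (pg_step M mu tau eta pi)
       (soft_reward M tau (pg_step M mu tau eta pi)) (V_ M tau pi) s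
     - V_ M tau pi s.
Proof.
set pi' := pg_step M mu tau eta pi; have [hpi_pol pi_gt0] := hpi.
have gap := subr_discount_gt0 M.
have [hpi'_pol _] := pg_step_softmax M mu tau eta hpi.
pose adv a := A_ M tau pi s a.
have [b _] := dist_inhabited (hpi_pol s).
have [a0 _ a0_max] :=
  Order.TotalTheory.arg_maxP (fun a => `|pi s a * adv a|) (isT : xpredT b).
have [a1 _ a1_max] :=
  Order.TotalTheory.arg_maxP (fun a => `|adv a|) (isT : xpredT b).
set X := `|pi s a0 * adv a0|; set Y := `|adv a1|.
have X_ge0 : 0 <= X by exact: normr_ge0.
have Y_ge0 : 0 <= Y by exact: normr_ge0.
have adv0 : \sum_a pi s a * adv a = 0 by exact: sum_pi_advantage.
(* The maximizers [a0] and [a1] may differ; evaluating [pi * adv] at [a1] still compares [X] with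
   [Y]. *)
have kY_le : kap * Y <= X.
  apply: le_trans (a0_max a1 isT); rewrite normrM gtr0_norm//.
  exact: ler_wpM2r.
pose eta_s := eta / (1 - discount M) * visitation M mu pi s.
have /andP[vis_ge vis_le] := visitation_bounds M hmu hpi_pol s.
have eta_gap_ge0 : 0 <= eta / (1 - discount M).
  exact: divr_ge0 eta_ge0 (ltW gap).
have eta_s_le : eta_s <= eta / (1 - discount M) by exact: ler_piMr.
(* The factor [1 - discount M] in the lower visitation bound cancels the denominator of [eta_s]. *)
have eta_s_ge : eta * m <= eta_s.
  rewrite (_ : eta * m = eta / (1 - discount M) * ((1 - discount M) * m)).
    by apply: ler_wpM2l => //; apply: le_trans vis_ge; rewrite ler_pM2l.
  by field; exact: lt0r_neq0.
have eta_s_ge0 : 0 <= eta_s by apply: le_trans eta_s_ge; rewrite mulr_ge0.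
(* The bounds on [eta_s] and on [X] each contribute one factor to the squared denominator of
   [exp_factor]. *)
have exp_ge : exp_factor M tau eta <= expR (- (2 * (eta_s * X))).
  rewrite ler_expR lerN2.
  rewrite (_ : 2 * eta * _ / _ = 2 * (eta / (1 - discount M) *
      ((1 + tau * ln (#|A|%:R)) / (1 - discount M)))).
    by rewrite ler_pM2l// ler_pM// pi_advantage_le.
  by field; exact: lt0r_neq0.
have gain := softmax_gain_ge (ltW htau) eta_s_ge0 (hpi_pol s) (pi_gt0 s) adv0
  (erefl X) (fun a => a0_max a isT) (fun a => erefl (pi' s a)).
have gap_le := softmax_gap_le htau (hpi_pol s) (pi_gt0 s) adv0
  (fun a => a1_max a isT) (hp s).
rewrite !bellman_V_sub//; apply: le_trans gain.
have B_le : B / 2 <= expR (- (2 * (eta_s * X))) - tau * eta_s / 2.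
  have := ler_wpM2l (ltW htau) eta_s_le; rewrite Bdef; lra.
have c_ge0 : 0 <= eta * m * tau * kap ^+ 2 * B.
  by rewrite !(mulr_ge0, exprn_ge0)// ltW.
apply: le_trans (ler_wpM2l c_ge0 gap_le) _.
have XX : (kap * Y) ^+ 2 <= X ^+ 2.
  by rewrite lerXn2r ?nnegrE ?mulr_ge0.
rewrite (_ : _ * (Y ^+ 2 / (2 * tau)) = eta * m * (kap * Y) ^+ 2 * (B / 2)); last first.
  by field; exact: lt0r_neq0.
have m_eta_ge0 : 0 <= eta * m by exact: mulr_ge0.
have kY2_ge0 : 0 <= (kap * Y) ^+ 2 by exact: sqr_ge0.
apply: ler_pM B_le; [exact: mulr_ge0 | exact: divr_ge0 | exact: ler_pM].
Qed.

(** * Sup-norm contraction and its iteration *)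

Lemma le_norm_oo (R : realType) (S : finType) (v : S -> R) (s : S) :
  v s <= norm_oo v.
Proof.
apply: le_trans (ler_norm _) _; exact: (le_bigmax _ (fun s => `|v s|)).
Qed.

Lemma norm_oo_ge0 (R : realType) (S : finType) (v : S -> R) : 0 <= norm_oo v.
Proof. exact: bigmax_ge_id. Qed.

(** With [D] the current error norm, passing from one step of [p] to its full value costs
    [c * (discount M * D)]. After the supremum over [p], a share [1 - c] of the error is bounded by
    [D], and [1 - c + c * discount M] is the rate. *)
Lemma pg_step_contraction (R : realType) (S A : finType) (M : mdp R S A)
    (mu : S -> R) (tau : R) (htau : 0 < tau) (eta : R) (pi : S -> A -> R)
    (hpi : is_softmax_policy pi) (c : R) (c_01 : 0 <= c <= 1) :
  let V := V_ M tau pi in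
  let pi' := pg_step M mu tau eta pi in
  (forall (p : S -> A -> R) s, is_policy p ->
    c * (bellman M p (soft_reward M tau p) V s - V s)
    <= bellman M pi' (soft_reward M tau pi') V s - V s) ->
  norm_oo (fun s => Vstar M tau s - V_ M tau pi' s)
  <= (1 - (1 - discount M) * c) * norm_oo (fun s => Vstar M tau s - V s).
Proof.
move=> V pi' gain; have /andP[c_ge0 c_le1] := c_01.
have [hpi_pol _] := hpi; have [hpi'_pol _] := pg_step_softmax M mu tau eta hpi.
set D := norm_oo (fun s => Vstar M tau s - V s).
have D_ge0 : 0 <= D by exact: norm_oo_ge0.
have V_sub_le p s : is_policy p -> V_ M tau p s - V s <= D.
  move=> hp; apply: le_trans (le_norm_oo (fun s => Vstar M tau s - V s) s).
  by rewrite lerD2r V_le_Vstar.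
(* Taking [pi] itself as competitor shows that the Bellman step of [pi'] does not decrease [V], as
   [bellman_le_V] requires. *)
have improve s : bellman M pi' (soft_reward M tau pi') V s <= V_ M tau pi' s.
  apply: bellman_le_V => // {}s; rewrite -subr_ge0; apply: le_trans (gain pi s hpi_pol).
  by rewrite /V -V_bellman// subrr mulr0.
have gam := discount_ge0 M; have gap := subr_discount_gt0 M.
have policy_le p s : is_policy p ->
    c * (V_ M tau p s - V s) <= V_ M tau pi' s - V s + c * (discount M * D).
  move=> hp.
  have avg : \sum_a p s a * \sum_s' trans M s a s' * (V_ M tau p s' - V s') <= D.
    apply: sum_dist_le => // a; apply: sum_dist_le => [|s']; first exact: trans_dist.
    exact: V_sub_le.
  have := ler_wpM2l c_ge0 (ler_wpM2l gam avg).
  rewrite -(bellmanB M p (soft_reward M tau p)) -V_bellman//.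
  have := gain p s hp; have := improve s; lra.
have star_le s :
    c * (Vstar M tau s - V s) <= V_ M tau pi' s - V s + c * (discount M * D).
  (* Passing to the supremum divides by [c], so [c = 0] is treated apart. *)
  have [c0|c_neq0] := eqVneq c 0.
    by have := policy_le pi s hpi_pol; rewrite c0 !mul0r.
  have c_gt0 : 0 < c by rewrite lt_def c_neq0.
  rewrite mulrC -ler_pdivlMr// lerBlDr.
  apply: (Vstar_le hpi_pol) => p hp.
  by rewrite -lerBlDr ler_pdivlMr// mulrC policy_le.
have rate_ge0 : 0 <= 1 - (1 - discount M) * c by nra.
apply: bigmax_le => [|s _]; first by rewrite mulr_ge0.
rewrite ger0_norm ?subr_ge0 ?V_le_Vstar//.
have sD : Vstar M tau s - V s <= D := le_norm_oo (fun s => Vstar M tau s - V s) s.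
have c1 : 0 <= 1 - c by rewrite subr_ge0.
have := ler_wpM2l c1 sD; have := star_le s; lra.
Qed.

Theorem theorem6p9 (R : realType) (S A : finType) (M : mdp R S A)
    (mu : S -> R) (hmu : is_dist mu) (hmu_pos : 0 < min_prob mu)
    (tau : R) (htau : 0 < tau)
    (beta : R) (hbeta : unique (beta_equation M tau) beta)
    (eta : R) (heta : 0 < eta < beta)
    (pi0 : S -> A -> R) (hpi0 : is_softmax_policy pi0)
    (pis : nat -> S -> A -> R)
    (hpis : pis = entropy_softmax_pg M mu tau eta pi0) (k : nat) :
  norm_oo (fun s => Vstar M tau s - V_ M tau (pis k) s)
  <= (1 - (1 - discount M) * eta * min_prob mu * tau * kappa pis ^+ 2
          * (2 * exp_factor M tau eta - tau * eta / (1 - discount M))) ^+ k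
     * norm_oo (fun s => Vstar M tau s - V_ M tau (pis 0%N) s).
Proof.
have /andP[eta_gt0 eta_lt] := heta.
have gap := subr_discount_gt0 M; have gam := discount_ge0 M.
have hpis_softmax j : is_softmax_policy (pis j).
  by rewrite hpis; exact: entropy_softmax_pg_softmax.
have [s0 _] := dist_inhabited hmu; have [a0 _] := dist_inhabited ((hpi0.1) s0).
have m_le s : min_prob mu <= mu s by exact: bigmin_le_cond.
have m_le1 : min_prob mu <= 1 := le_trans (m_le s0) (dist_le1 s0 hmu).
have min_ge0 j : 0 <= min_prob (fun sa : S * A => pis j sa.1 sa.2).
  by apply: le_bigmin => // x _; rewrite ltW// (hpis_softmax j).2.
have kappa_ge0 : 0 <= kappa pis.
  apply: lb_le_inf; first by exists (min_prob (fun sa : S * A => pis 0%N sa.1 sa.2)), 0%N.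
  by move=> _ [j _ <-].
have kappa_le j s a : kappa pis <= pis j s a.
  apply: (@le_trans _ _ (min_prob (fun sa : S * A => pis j sa.1 sa.2))).
    by apply: ge_inf; [exists 0 => _ [i _ <-] | exists j].
  exact: (bigmin_le_cond _ (fun sa : S * A => pis j sa.1 sa.2) (isT : xpredT (s, a))).
have kappa_le1 : kappa pis <= 1.
  by apply: le_trans (kappa_le 0%N s0 a0) _; apply/dist_le1/(hpis_softmax 0%N).1.
have lnA_ge0 : 0 <= ln (#|A|%:R : R).
  by rewrite ln_ge0// ler1n; apply/card_gt0P; exists a0.
have w_ge0 : 0 <= (1 + tau * ln (#|A|%:R)) / (1 - discount M) ^+ 2.
  by rewrite divr_ge0 ?sqr_ge0// addr_ge0// mulr_ge0// ltW.
set B := 2 * exp_factor M tau eta - tau * eta / (1 - discount M).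
(* [exp_factor] decreases and the linear term increases with the step size, so the equation at
   [beta] makes the bracket nonnegative at [eta < beta]. *)
have B_ge0 : 0 <= B.
  have Ebeta : exp_factor M tau beta <= exp_factor M tau eta.
    rewrite ler_expR lerN2 -!mulrA ler_pM2l// ler_wpM2r//; exact: ltW.
  have beta_eq : exp_factor M tau beta
    - tau * beta / (2 * (1 - discount M)) = 0 := hbeta.1.
  have : tau * eta / (1 - discount M) <= tau * beta / (1 - discount M).
    by rewrite ler_pM2r ?invr_gt0// ler_pM2l// ltW.
  have : tau * beta / (2 * (1 - discount M)) = tau * beta / (1 - discount M) / 2.
    by field; exact: lt0r_neq0.
  rewrite /B; lra.
have te_ge0 : 0 <= tau * eta by rewrite mulr_ge0// ltW.
have B_le : B <= 2 - tau * eta.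
  have : exp_factor M tau eta <= 1.
    by rewrite -expR0 ler_expR oppr_le0 -mulrA mulr_ge0// mulr_ge0// ltW.
  have : tau * eta <= tau * eta / (1 - discount M).
    by rewrite ler_pdivlMr// ler_piMr// lerBlDr lerDl.
  rewrite /B; lra.
set c := eta * min_prob mu * tau * kappa pis ^+ 2 * B.
have c_01 : 0 <= c <= 1.
  have mk_01 : 0 <= min_prob mu * kappa pis ^+ 2 <= 1.
    rewrite mulr_ge0 ?sqr_ge0 ?(ltW hmu_pos)//=.
    by rewrite mulr_ile1 ?sqr_ge0 ?(ltW hmu_pos)// exprn_ile1.
  (* With [u = tau * eta], the bound [u * (2 - u) <= 1] is [(u - 1) ^+ 2 >= 0]. *)
  have teB : 0 <= tau * eta * B <= 1.
    rewrite mulr_ge0//=; apply: le_trans (ler_wpM2l te_ge0 B_le) _.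
    have := sqr_ge0 (tau * eta - 1); lra.
  rewrite (_ : c = min_prob mu * kappa pis ^+ 2 * (tau * eta * B)); last first.
    by rewrite /c; ring.
  move: mk_01 teB => /andP[? ?] /andP[? ?]; rewrite mulr_ge0//=.
  exact: mulr_ile1.
rewrite (_ : _ * B = (1 - discount M) * c); last by rewrite /c; ring.
(* The induction hypothesis gets multiplied by the rate, which must be nonnegative. *)
have rate_ge0 : 0 <= 1 - (1 - discount M) * c by move: c_01 => /andP[? ?]; nra.
elim: k => [|k IH]; first by rewrite expr0 mul1r.
rewrite exprS -mulrA; apply: le_trans (ler_wpM2l rate_ge0 IH).
have -> : pis k.+1 = pg_step M mu tau eta (pis k) by rewrite hpis.
apply: pg_step_contraction => // p s hp.
rewrite /c; apply: (pg_step_gain hmu) => //; [exact: ltW | exact: ltW].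
Qed.
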